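(* Let $\lambda>0$ and let $k$ be an integer with $k\ge(\lambda+1)+\sqrt{(\lambda+1)(5\lambda+1)}$. Then $$\mathfrak{C}_{1-}(\lambda,k)>\mathfrak{C}_{1+}(\lambda,k),$$ where $$\mathfrak{C}_{1+}(\lambda,k)=\frac{F(k-1)}{k\pi_k}\left(1-\frac{\overline{F}(k+1)}{\overline{F}(k)}\cdot\frac{k}{\lambda}\right),\qquad \mathfrak{C}_{1-}(\lambda,k)=\frac{F(k-1)}{k\pi_k}\left(1-\frac{F(k-2)}{F(k-1)}\cdot\frac{\lambda}{k-1}\right).$$
   Context: $\pi_j=e^{-\lambda}\lambda^j/j!$ for $j=0,1,2,\dots$ are the Poisson probabilities with mean $\lambda$; $F(n)=\sum_{j=0}^n\pi_j$ and $\overline{F}(n)=\sum_{j=n}^\infty\pi_j$. *)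

(* Defs.v *)
From mathcomp Require Import all_boot all_order all_algebra.
From mathcomp Require Import all_classical all_reals all_analysis.

Set Implicit Arguments.
Unset Strict Implicit.
Unset Printing Implicit Defensive.

Import Order.TTheory GRing.Theory Num.Theory.
Import numFieldNormedType.Exports.

Local Open Scope classical_set_scope.
Local Open Scope ring_scope.

(* For 0 < lam, [poisson_pmf lam j] unfolds to
   lam ^+ j / j`! * expR (- lam); its value for lam <= 0 is a library
   convention that plays no role here. *)

Definition poisson_cdf (R : realType) (lam : R) (n : nat) : R :=
  \sum_(0 <= j < n.+1) poisson_pmf lam j.

(* The tail includes the atom at n: it is P(X >= n). *)
Definition poisson_tail (R : realType) (lam : R) (n : nat) : R :=
  \big[+%R/0]_(n <= j <oo) poisson_pmf lam j.

(* [(k - 1)%N] and [(k - 2)%N] are truncated subtractions, hence the intended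
   indices only for k >= 2. *)

Definition C1plus (R : realType) (lam : R) (k : nat) : R :=
  poisson_cdf lam (k - 1) / (k%:R * poisson_pmf lam k)
  * (1 - poisson_tail lam (k + 1) / poisson_tail lam k * (k%:R / lam)).

Definition C1minus (R : realType) (lam : R) (k : nat) : R :=
  poisson_cdf lam (k - 1) / (k%:R * poisson_pmf lam k)
  * (1 - poisson_cdf lam (k - 2) / poisson_cdf lam (k - 1)
         * (lam / (k%:R - 1))).

(* Main.v *)
(* Estimate the two quotients of the statement in opposite directions.  Keeping
   only the atom at [k + 1] of the tail gives
   [tail (k + 1) / tail k * (k / lam) >= k / (k + 1 + lam)],
   whereas [cdf (k - 2) < cdf (k - 1)] gives
   [cdf (k - 2) / cdf (k - 1) * (lam / (k - 1)) < lam / (k - 1)].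
   The two bounds compare as soon as [k ^ 2 - (lam + 1) k - lam (lam + 1) >= 0],
   whose largest root is half of the threshold imposed on [k]. *)
Require Import Defs.
From mathcomp Require Import all_boot all_order all_algebra.
From mathcomp Require Import all_classical all_reals all_analysis.
From mathcomp Require Import ring lra.

Import Order.TTheory GRing.Theory Num.Theory.
Import numFieldNormedType.Exports.

Local Open Scope ring_scope.

Lemma poisson_pmf_gt0 {R : realType} (lam : R) (n : nat) :
  0 < poisson_pmf lam n.
Proof.
rewrite /poisson_pmf; case: ifPn => // lam_gt0.
by rewrite !mulr_gt0 ?exprn_gt0 ?invr_gt0 ?ltr0n ?fact_gt0 ?expR_gt0.
Qed.

Lemma poisson_pmfS {R : realType} (lam : R) (n : nat) : 0 < lam ->
  poisson_pmf lam n.+1 = lam / n.+1%:R * poisson_pmf lam n.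
Proof.
move=> lam_gt0; rewrite /poisson_pmf lam_gt0 exprS factS natrM invfM.
by ring.
Qed.

Lemma is_cvg_series_poisson_pmf {R : realType} (lam : R) : 0 < lam ->
  cvgn (series (poisson_pmf lam)).
Proof.
move=> lam_gt0.
have -> : poisson_pmf lam = expR (- lam) *: exp_coeff lam.
  by apply/funext => n; rewrite /poisson_pmf lam_gt0 mulrC.
exact/is_cvg_seriesZ/is_cvg_series_exp_coeff.
Qed.

(** [series _ n] stops before index [n], so the atom at [n] stays in the tail. Recursion and sign of
    the tail then follow from facts on partial sums. *)
Lemma poisson_tailE {R : realType} (lam : R) (n : nat) : 0 < lam ->
  poisson_tail lam n =
  limn (series (poisson_pmf lam)) - series (poisson_pmf lam) n.
Proof.
move=> lam_gt0; apply/cvg_lim => //.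
(* The two sequences are compared only for [m >= n], where the difference is the sum over
   [n <= j < m]. *)
apply: (@cvg_trans _ (series (poisson_pmf lam) m -
    series (poisson_pmf lam) n @[m --> \oo])%classic).
  apply: near_eq_cvg; near=> m.
  by rewrite sub_series_geq//; near: m; exact: nbhs_infty_ge.
by apply: cvgB; [exact: is_cvg_series_poisson_pmf|exact: cvg_cst].
Unshelve. all: by end_near. Qed.

Lemma poisson_tailS {R : realType} (lam : R) (n : nat) : 0 < lam ->
  poisson_tail lam n = poisson_pmf lam n + poisson_tail lam n.+1.
Proof.
by move=> lam_gt0; rewrite !poisson_tailE// seriesSr; ring.
Qed.

Lemma poisson_tail_ge0 {R : realType} (lam : R) (n : nat) : 0 < lam ->
  0 <= poisson_tail lam n.
Proof.
move=> lam_gt0; rewrite poisson_tailE// subr_ge0.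
apply: nondecreasing_cvgn_le; last exact: is_cvg_series_poisson_pmf.
by apply/nondecreasing_seqP => m; rewrite seriesSr lerDl poisson_pmf_ge0.
Qed.

(** With [p] the atom at [k], the quotient [t / (p + t)] increases in [t], and [t] is at least the
    atom [lam / (k + 1) * p]. *)
Lemma poisson_tail_ratio_ge {R : realType} (lam : R) (k : nat) : 0 < lam ->
  k%:R / (k%:R + 1 + lam) <=
  poisson_tail lam k.+1 / poisson_tail lam k * (k%:R / lam).
Proof.
move=> lam_gt0; rewrite (poisson_tailS lam k)//.
set t := poisson_tail lam k.+1; have p_gt0 := poisson_pmf_gt0 lam k.
have k_ge0 : 0 <= k%:R :> R by [].
have le_pt : lam / (k%:R + 1) * poisson_pmf lam k <= t.
  rewrite natr1 -poisson_pmfS// /t (poisson_tailS lam k.+1)// lerDl.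
  exact: poisson_tail_ge0.
move: le_pt; rewrite mulrAC ler_pdivrMr; last by lra.
move=> le_pt.
have t_gt0 : 0 < t.
  by rewrite /t poisson_tailS// ltr_wpDr ?poisson_tail_ge0 ?poisson_pmf_gt0.
rewrite mulrACA -invfM [t * _]mulrC -mulrA ler_wpM2l// -[leLHS]mul1r.
rewrite ler_pdivrMr; last by lra.
rewrite mulrAC ler_pdivlMr; last by rewrite mulr_gt0//; lra.
(* The terms [t * lam] cancel, which leaves [le_pt]. *)
by nra.
Qed.

Lemma poisson_cdf_ratio_lt1 {R : realType} (lam : R) (n : nat) :
  poisson_cdf lam n / poisson_cdf lam n.+1 < 1.
Proof.
have cdfS m : poisson_cdf lam m.+1 =
  poisson_cdf lam m + poisson_pmf lam m.+1 by rewrite /poisson_cdf big_nat_recr.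
have cdf_ge0 : 0 <= poisson_cdf lam n.
  by apply: sumr_ge0 => *; exact: poisson_pmf_ge0.
rewrite cdfS ltr_pdivrMr ?mul1r ?ltrDl ?poisson_pmf_gt0//.
by rewrite ltr_wpDl ?poisson_pmf_gt0.
Qed.

Theorem proposition1 (R : realType) (lam : R) (k : nat)
    (lam_gt0 : 0 < lam)
    (hk : k%:R >= (lam + 1) + Num.sqrt ((lam + 1) * (5 * lam + 1))) :
  C1minus lam k > C1plus lam k.
Proof.
(* Replaces the root by a linear bound: the radicand exceeds [(2 * lam + 1) ^ 2] by
   [lam ^ 2 + 2 * lam]. *)
have le_sqrt : 2 * lam + 1 <= Num.sqrt ((lam + 1) * (5 * lam + 1)).
  rewrite -[leLHS]ger0_norm; last by lra.
  by rewrite -sqrtr_sqr ler_wsqrtr//; nra.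
have k_ge : 3 * lam + 2 <= k%:R by lra.
(* Keeps the truncated [k - 1] and [k - 2] consecutive. *)
have k_gt2 : (2 < k)%N by rewrite -(ltr_nat R); lra.
rewrite /C1plus /C1minus ltr_pM2l; last first.
  rewrite divr_gt0 ?mulr_gt0 ?poisson_pmf_gt0//; last by lra.
  rewrite /poisson_cdf big_nat_recr//= ltr_wpDl ?poisson_pmf_gt0//.
  by apply: sumr_ge0 => *; exact: poisson_pmf_ge0.
rewrite ltrD2l ltrN2 addn1.
apply: (lt_le_trans _ (poisson_tail_ratio_ge lam k lam_gt0)).
apply: (@lt_le_trans _ _ (lam / (k%:R - 1))).
  rewrite -[ltRHS]mul1r ltr_pM2r; last by rewrite divr_gt0//; lra.
  have -> : (k - 1)%N = (k - 2).+1 by rewrite subnSK// ltnW.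
  exact: poisson_cdf_ratio_lt1.
rewrite ler_pdivrMr; last by lra.
rewrite mulrAC ler_pdivlMr; last by lra.
(* By [k_ge], [k * (k - lam - 1) >= (3 * lam + 2) * (2 * lam + 1)], which exceeds
   [lam * (lam + 1)]. *)
by nra.
Qed.
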